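(* Let $A\in\mathbb{R}^{s\times d}$, $b^\delta\in\mathbb{R}^s$, $f(u)=\frac12\|Au-b^\delta\|^2$. Let $h:\mathbb{R}^{d'}\to\mathbb{R}\cup\{\infty\}$ be proper, convex and lower semicontinuous, and let $W\in\mathbb{R}^{d'\times d}$ be such that $Wu_*\in\operatorname{relint}(\operatorname{dom}(h))$ for some $u_*\in\mathbb{R}^d$. Assume that $\min_{u\in\mathbb{R}^d} f(u)+h(Wu)$ has at least one solution. Let $R\in\mathbb{R}^{d\times d}$ be invertible and set $\tilde A=AR^{-1}$, $\tilde W=WR^{-1}$, $\tilde f(z)=\frac12\|\tilde Az-b^\delta\|^2$. With $z=Ru$, the problem is equivalent to its right-preconditioned form: the solutions $\hat u$ of $\min_u f(u)+h(Wu)$ are given by $\hat u=R^{-1}\hat z$ with $\hat z\in\arg\min_{z\in\mathbb{R}^d}\tilde f(z)+h(\tilde Wz)$. Let $\{z_n\}$ be generated by the Nested Primal-Dual (NPD) method, with inexact nested proximal evaluations, applied to the right-preconditioned problem $\min_z\tilde f(z)+h(\tilde Wz)$, that is, for $n\ge0$, $$\bar z_n=z_n+\gamma_n(z_n-z_{n-1}),\qquad z_{n+1}\approx\operatorname{prox}_{\alpha_nh\circ\tilde W}\left(\bar z_n-\alpha_n\nabla\tilde f(\bar z_n)\right),$$ with $z_{-1}=z_0\in\mathbb{R}^d$, $\alpha_n>0$, $\gamma_n\ge0$. Then, in terms of $u_n=R^{-1}z_n$ and $\bar u_n=R^{-1}\bar z_n$, this method is the iterative scheme $$\bar u_n=u_n+\gamma_n(u_n-u_{n-1}),\qquad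 u_{n+1}\approx\operatorname{prox}^{R^TR}_{\alpha_nh\circ W}\left(\bar u_n-\alpha_n(R^TR)^{-1}\nabla f(\bar u_n)\right),\qquad n\ge 0.$$ Here ''$\approx$'' denotes in both schemes the nested primal-dual approximation of the proximal point described in the context (in the metric of the identity for the $z$-scheme, in the metric of $R^TR$ for the $u$-scheme), with the same number $k_{\max}$ of inner iterations, the same parameters $\alpha_n,\beta_n$ and the same initial dual vector. In particular, let $\eta>0$ and let $P\in\mathbb{R}^{d\times d}$ be a symmetric positive definite matrix with all eigenvalues at least $\eta$ (a stationary preconditioner). Choosing $R=P^{1/2}$, so that $R^TR=P$, the scheme is exactly the inexact inertial variable metric forward-backward scheme with stationary scaling matrix $P$: $$\bar u_n=u_n+\gamma_n(u_n-u_{n-1}),\qquad u_{n+1}\approx\operatorname{prox}^{P}_{\alpha_nh\circ W}\left(\bar u_n-\alpha_nP^{-1}\nabla f(\bar u_n)\right).$$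
   Context: $\|\cdot\|$ is the Euclidean norm (and the induced matrix norm); for symmetric positive definite $M$, $\|u\|_M=\sqrt{u^TMu}$. $\operatorname{dom}(h)=\{x:h(x)<\infty\}$, $\operatorname{relint}$ is the relative interior, $(h\circ W)(u)=h(Wu)$, and $h^*(v)=\sup_{w}\langle v,w\rangle-h(w)$ is the convex conjugate. For a proper convex lower semicontinuous function $\varphi$, $\gamma>0$ and $M$ symmetric positive definite, $$\operatorname{prox}_{\gamma\varphi}(a)=\arg\min_{u}\varphi(u)+\frac1{2\gamma}\|u-a\|^2,\qquad \operatorname{prox}^M_{\gamma\varphi}(a)=\arg\min_{u}\varphi(u)+\frac1{2\gamma}\|u-a\|_M^2.$$ Nested primal-dual approximation (''$\approx$''). Fix $k_{\max}\ge1$. At outer iteration $n$, for a matrix $B\in\mathbb{R}^{d'\times d}$, a symmetric positive definite $M\in\mathbb{R}^{d\times d}$, a point $a\in\mathbb{R}^d$, a step $\alpha_n>0$, a dual step $0<\beta_n<2/\|BM^{-1}B^T\|$ and a dual vector $v_n^0\in\mathbb{R}^{d'}$, the approximation of $\operatorname{prox}^M_{\alpha_nh\circ B}(a)$ is computed by $$x_n^k=a-\alpha_nM^{-1}B^Tv_n^k,\qquad v_n^{k+1}=\operatorname{prox}_{\beta_n\alpha_n^{-1}h^*}\left(v_n^k+\beta_n\alpha_n^{-1}Bx_n^k\right),\qquad k=0,\dots,k_{\max}-1,$$ $$x_n^{k_{\max}}=a-\alpha_nM^{-1}B^Tv_n^{k_{\max}},$$ and the approximate proximal point is the average $\frac1{k_{\max}}\sum_{j=1}^{k_{\max}}x_n^j$.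 The inner loop is warm started: $v_{n+1}^0=v_n^{k_{\max}}$, with $v_0^0\in\mathbb{R}^{d'}$ given. For the $z$-scheme (NPD) one takes $M=I$, $B=\tilde W$; for the $u$-scheme (variable metric) one takes $M=R^TR$, $B=W$. The bounds on $\beta_n$ coincide in the two cases, since $\tilde W\tilde W^T=W(R^TR)^{-1}W^T$. *)

(* Defs.v *)
From HB Require Import structures.
From mathcomp Require Import all_boot all_order all_algebra.
From mathcomp Require Import all_classical all_reals all_analysis.

Set Implicit Arguments.
Unset Strict Implicit.
Unset Printing Implicit Defensive.

Import Order.TTheory GRing.Theory Num.Theory.
Import numFieldNormedType.Exports.

Local Open Scope classical_set_scope.
Local Open Scope ring_scope.

(* Vectors of the Euclidean space of dimension n are columns 'cV[K]_n.  The
   library's norm `|x| on matrices is the max norm: it is used only through the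
   topology it induces, and the Euclidean norm is [enorm]. *)

Section Euclidean.
Variable K : realType.

Definition dot n (u v : 'cV[K]_n) : K := (u^T *m v) ord0 ord0.

Definition enorm n (u : 'cV[K]_n) : K := Num.sqrt (dot u u).

Definition mnorm n (M : 'M[K]_n) (u : 'cV[K]_n) : K :=
  Num.sqrt (dot u (M *m u)).

Definition opnorm m n (A : 'M[K]_(m, n)) : K :=
  sup [set enorm (A *m u) | u in [set u : 'cV[K]_n | enorm u <= 1]].

Definition posdefmx n (M : 'M[K]_n) : Prop :=
  M^T = M /\ forall u : 'cV[K]_n, u != 0 -> 0 < dot u (M *m u).

(* The symmetric positive definite square root, for M symmetric positive
   definite. *)
Definition sqrtmx n (M : 'M[K]_n) : 'M[K]_n :=
  get [set S : 'M[K]_n | posdefmx S /\ S *m S = M].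

Definition gradient n (f : 'cV[K]_n -> K) (x : 'cV[K]_n) : 'cV[K]_n :=
  \col_i 'D_(delta_mx i ord0) f x.

End Euclidean.

Section ConvexAnalysis.
Variable K : realType.
Local Open Scope ereal_scope.

Definition proper_efun n (h : 'cV[K]_n -> \bar K) : Prop :=
  (forall x, h x != -oo) /\ exists x, h x < +oo.

(* The right-hand side is a well-defined extended real as soon as h is
   proper. *)
Definition convex_efun n (h : 'cV[K]_n -> \bar K) : Prop :=
  forall (x y : 'cV[K]_n) (t : K), (0 < t < 1)%R ->
    h (t *: x + (1 - t) *: y)%R <= t%:E * h x + (1 - t)%R%:E * h y.

Definition effdom n (h : 'cV[K]_n -> \bar K) : set 'cV[K]_n :=
  [set x | h x < +oo].

Definition affine_hull n (C : set 'cV[K]_n) : set 'cV[K]_n :=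
  [set x | exists (m : nat) (c : 'I_m -> K) (p : 'I_m -> 'cV[K]_n),
     [/\ (\sum_i c i = 1)%R, forall i, C (p i) & x = (\sum_i c i *: p i)%R]].

Definition relint n (C : set 'cV[K]_n) : set 'cV[K]_n :=
  [set x | C x /\ \forall y \near x, affine_hull C y -> C y].

Definition conjugate n (h : 'cV[K]_n -> \bar K) (v : 'cV[K]_n) : \bar K :=
  ereal_sup [set (dot v w)%:E - h w | w in setT].

Definition argmin (T : Type) (F : T -> \bar K) : set T :=
  [set u | forall w, F u <= F w].

(* [prox M gamma phi a] is the proximal point of gamma * phi at a in the metric
   of M.  For phi proper, convex and lower semicontinuous, gamma > 0 and M
   symmetric positive definite, the argmin is a singleton, and [get] returns its
   element.  The Euclidean proximal operator is the case M = 1%:M. *)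
Definition prox n (M : 'M[K]_n) (gamma : K) (phi : 'cV[K]_n -> \bar K)
    (a : 'cV[K]_n) : 'cV[K]_n :=
  get (argmin (fun u =>
    phi u + ((2 * gamma)^-1 * mnorm M (u - a) ^+ 2)%R%:E)).

End ConvexAnalysis.

Section NestedPrimalDual.
Variable K : realType.

Definition lsq s d (A : 'M[K]_(s, d)) (b : 'cV[K]_s) (u : 'cV[K]_d) : K :=
  2^-1 * enorm (A *m u - b) ^+ 2.

Definition composite d d' (f : 'cV[K]_d -> K) (h : 'cV[K]_d' -> \bar K)
    (B : 'M[K]_(d', d)) (u : 'cV[K]_d) : \bar K :=
  ((f u)%:E + h (B *m u))%E.

Definition npd_primal d d' (M : 'M[K]_d) (B : 'M[K]_(d', d)) (alpha : K)
    (a : 'cV[K]_d) (v : 'cV[K]_d') : 'cV[K]_d :=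
  a - alpha *: (invmx M *m B^T *m v).

(* [p] is the nested primal-dual approximation of prox^M_{alpha (h o B)}(a)
   computed by kmax inner iterations, with dual iterates v 0, ..., v kmax.
   The quotient bounding beta is taken in the extended reals, where it is +oo
   if the norm vanishes. *)
Definition npd_approx d d' (h : 'cV[K]_d' -> \bar K) (B : 'M[K]_(d', d))
    (M : 'M[K]_d) (kmax : nat) (alpha beta : K) (a : 'cV[K]_d)
    (v : nat -> 'cV[K]_d') (p : 'cV[K]_d) : Prop :=
  let x k := npd_primal M B alpha a (v k) in
  [/\ posdefmx M,
      0 < beta /\ (beta%:E < 2%:E / (opnorm (B *m invmx M *m B^T))%:E)%E,
      forall k, (k < kmax)%N ->
        v k.+1 = prox 1%:M (beta / alpha) (conjugate h)
                   (v k + (beta / alpha) *: (B *m x k)) &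
      p = kmax%:R^-1 *: \sum_(1 <= j < kmax.+1) x j].

(* Inertial forward-backward iteration with forward steps [fwd n], inexact
   proximal evaluations in the metric of M and warm-started inner loops; [v n k]
   is the k-th dual iterate of the inner loop of outer iteration n.  Since
   0.-1 = 0, the extrapolation at n = 0 encodes the convention x_{-1} = x_0. *)
Definition nested_scheme d d' (fwd : nat -> 'cV[K]_d -> 'cV[K]_d)
    (h : 'cV[K]_d' -> \bar K) (B : 'M[K]_(d', d)) (M : 'M[K]_d) (kmax : nat)
    (alpha beta gamma : nat -> K) (v00 : 'cV[K]_d')
    (x xbar : nat -> 'cV[K]_d) (v : nat -> nat -> 'cV[K]_d') : Prop :=
  [/\ v 0%N 0%N = v00,
      forall n, v n.+1 0%N = v n kmax,
      forall n, xbar n = x n + gamma n *: (x n - x n.-1) &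
      forall n, npd_approx h B M kmax (alpha n) (beta n) (fwd n (xbar n))
                  (v n) (x n.+1)].

Definition npd d d' (f : 'cV[K]_d -> K) (h : 'cV[K]_d' -> \bar K)
    (B : 'M[K]_(d', d)) (kmax : nat) (alpha beta gamma : nat -> K) :=
  nested_scheme (fun n x => x - alpha n *: gradient f x)
    h B 1%:M kmax alpha beta gamma.

Definition variable_metric_npd d d' (P : 'M[K]_d) (f : 'cV[K]_d -> K)
    (h : 'cV[K]_d' -> \bar K) (B : 'M[K]_(d', d)) (kmax : nat)
    (alpha beta gamma : nat -> K) :=
  nested_scheme (fun n x => x - alpha n *: (invmx P *m gradient f x))
    h B P kmax alpha beta gamma.

End NestedPrimalDual.

(* Main.v *)
(* Under z = R u every matrix of the z-scheme is conjugated by R: the forward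
   step and the primal update become those in the metric of R^T R, because
   R^-1 R^-T = (R^T R)^-1 and grad (lsq (A R^-1) b) z = R^-T grad (lsq A b)
   (R^-1 z), whereas the dual updates only see W R^-1 z = W u and do not change.
   For R = P^(1/2) it remains to construct the square root; it is obtained as a
   polynomial in P, once the spectral theorem over K[i] has shown P to be
   diagonalizable over K. *)
Require Import Defs.
From mathcomp Require Import all_boot all_order all_algebra.
From mathcomp Require Import all_classical all_reals all_analysis.
From mathcomp Require Import ring.
From mathcomp.real_closed Require Import complex.

Set Implicit Arguments.
Unset Strict Implicit.
Unset Printing Implicit Defensive.

Import Order.TTheory GRing.Theory Num.Theory.
Import numFieldNormedType.Exports.

Local Open Scope classical_set_scope.
Local Open Scope ring_scope.

(** * The Euclidean inner product and norm *)

Lemma dotE (K : realType) n (u v : 'cV[K]_n) :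
  dot u v = \sum_i u i ord0 * v i ord0.
Proof. by rewrite /dot mxE; apply: eq_bigr => i _; rewrite mxE. Qed.

Lemma dotC (K : realType) n (u v : 'cV[K]_n) : dot u v = dot v u.
Proof. by rewrite !dotE; apply: eq_bigr => i _; rewrite mulrC. Qed.

Lemma dotDl (K : realType) n (u v w : 'cV[K]_n) :
  dot (u + v) w = dot u w + dot v w.
Proof. by rewrite /dot linearD mulmxDl mxE. Qed.

Lemma dotDr (K : realType) n (u v w : 'cV[K]_n) :
  dot u (v + w) = dot u v + dot u w.
Proof. by rewrite /dot mulmxDr mxE. Qed.

Lemma dotZl (K : realType) n (c : K) (u v : 'cV[K]_n) :
  dot (c *: u) v = c * dot u v.
Proof. by rewrite /dot linearZ -scalemxAl mxE. Qed.

Lemma dotZr (K : realType) n (c : K) (u v : 'cV[K]_n) :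
  dot u (c *: v) = c * dot u v.
Proof. by rewrite /dot -scalemxAr mxE. Qed.

Lemma dot_mulmxr (K : realType) m n (M : 'M[K]_(m, n)) u v :
  dot u (M *m v) = dot (M^T *m u) v.
Proof. by rewrite /dot trmx_mul trmxK mulmxA. Qed.

Lemma dot_ge0 (K : realType) n (u : 'cV[K]_n) : 0 <= dot u u.
Proof. by rewrite dotE; apply: sumr_ge0 => i _; rewrite -expr2 sqr_ge0. Qed.

Lemma dot_gt0 (K : realType) n (u : 'cV[K]_n) : (0 < dot u u) = (u != 0).
Proof.
rewrite lt_neqAle dot_ge0 andbT eq_sym; congr negb; apply/eqP/eqP; last first.
  by move=> ->; rewrite /dot mulmx0 mxE.
rewrite dotE => /psumr_eq0P u0; apply/colP => i; rewrite mxE.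
have /eqP := u0 (fun i _ => ltac:(by rewrite -expr2 sqr_ge0)) i isT.
by rewrite mulf_eq0 orbb => /eqP.
Qed.

Lemma sqr_enorm (K : realType) n (u : 'cV[K]_n) : enorm u ^+ 2 = dot u u.
Proof. by rewrite sqr_sqrtr // dot_ge0. Qed.

Lemma sqr_enormD (K : realType) n (u v : 'cV[K]_n) :
  enorm (u + v) ^+ 2 = enorm u ^+ 2 + 2 * dot u v + enorm v ^+ 2.
Proof. by rewrite !sqr_enorm dotDl !dotDr (dotC v u); ring. Qed.

(** * The gradient of the least-squares functional *)

Lemma gradient_lsq (K : realType) (s d : nat) (A : 'M[K]_(s, d)) b x :
  gradient (lsq A b) x = A^T *m (A *m x - b).
Proof.
apply/colP => i; rewrite !mxE; set v := delta_mx i ord0.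
have -> : \sum_j A^T i j * (A *m x - b) j ord0 = dot (A *m v) (A *m x - b).
  by rewrite dotE; apply: eq_bigr => j _; rewrite -colE !mxE.
set r := A *m x - b; set l := dot _ r; rewrite /derive; apply: cvg_lim => //.
set c := 2^-1 * dot (A *m v) (A *m v).
(* The functional is quadratic, so for t != 0 its difference quotient along v is exactly the affine
   function l + c t, whose limit at 0 is l. *)
have dq : {in [pred t | t != 0], (fun t : K => l + c * t)
    =1 (fun t => t^-1 *: ((lsq A b \o shift x) (t *: v) - lsq A b x))}.
  move=> t; rewrite inE => t0 /=.
  rewrite /lsq mulmxDr -scalemxAr -addrA -/r sqr_enormD sqr_enorm.
  rewrite !dotZl dotZr -/l /c /GRing.scale /=.
  by field.
apply: cvg_trans (_ : (fun t : K => l + c * t) @ 0^' --> l).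
  apply: near_eq_cvg; near=> t; apply: dq; rewrite inE.
  by near: t; exact: nbhs_dnbhs_neq.
apply: cvg_trans; first exact: cvg_app (@nbhs_dnbhs _ 0).
rewrite -[X in _ --> X]addr0 -[X in _ --> l + X](mulr0 c).
by apply: cvgD; [exact: cvg_cst|apply: cvgMr; exact: cvg_id].
Unshelve. all: by end_near. Qed.

(** * Positive definite matrices *)

Lemma posdefmx_unit (K : realType) n (M : 'M[K]_n) :
  posdefmx M -> M \in unitmx.
Proof.
move=> [Msym Mpos]; rewrite -row_free_unit -kermx_eq0.
(* A nonzero u in the left kernel of M would make the quadratic form vanish at u^T. *)
apply/rowV0P => u /sub_kermxP uM0; apply: contraTeq isT => u0.
have := Mpos u^T; rewrite -[u^T == 0](inj_eq trmx_inj) trmxK trmx0 => /(_ u0).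
by rewrite /dot trmxK mulmxA uM0 mul0mx mxE ltxx.
Qed.

Lemma posdefmx_gram (K : realType) n (R : 'M[K]_n) :
  R \in unitmx -> posdefmx (R^T *m R).
Proof.
move=> Ru; split=> [|u u0]; first by rewrite trmx_mul trmxK.
rewrite -mulmxA dot_mulmxr trmxK dot_gt0; apply: contraNneq u0 => Ru0.
by rewrite -[u](mulKmx Ru) Ru0 mulmx0.
Qed.

(** * Diagonalization and the square root *)

Lemma poly_interpolation (F : fieldType) (g : F -> F) (s : seq F) :
  exists p : {poly F}, {in s, forall x, p.[x] = g x}.
Proof.
elim: s => [|a s [p pE]]; first by exists 0.
have [as_|ans] := boolP (a \in s).
  by exists p => x; rewrite inE => /predU1P[->|]; apply: pE.
(* q vanishes on s but not at a: adding a multiple of it corrects the value at a and keeps those on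
   s. *)
pose q := \prod_(x <- s) ('X - x%:P).
have qa : q.[a] != 0 by rewrite -[_ == 0]/(root q a) root_prod_XsubC.
exists (p + ((g a - p.[a]) / q.[a]) *: q) => x.
rewrite hornerD hornerZ inE => /predU1P[->|xs].
  by rewrite divfK // addrC subrK.
have /rootP -> : root q x by rewrite root_prod_XsubC.
by rewrite mulr0 addr0 pE.
Qed.

Lemma trmx_horner_mx (K : comNzRingType) n (M : 'M[K]_n.+1) p :
  (horner_mx M p)^T = horner_mx M^T p.
Proof.
elim/poly_ind: p => [|p c IHp]; first by rewrite !rmorph0 trmx0.
rewrite !rmorphD !rmorphM /= !horner_mx_X !horner_mx_C linearD /= tr_scalar_mx.
rewrite -[(_ * M)^T]/((_ *m M)^T) trmx_mul IHp; congr (_ + _).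
exact: comm_mx_horner.
Qed.

(* Stated for an abstract C, to be instantiated with K[i], so that conversion
   never unfolds the arithmetic of K[i]. *)
Lemma symmetric_diagonalizable_in (K : realFieldType) (C : numClosedFieldType)
    (toC : {rmorphism K -> C}) (re : C -> K)
    (toC_real : forall x, toC x \is Num.real)
    (toC_re : {in Num.real, cancel re toC}) n (M : 'M[K]_n.+1) :
  M^T = M -> diagonalizable M.
Proof.
move=> Msym; pose MC := map_mx toC M.
have MCherm : MC \is hermsymmx.
  apply: realsym_hermsym.
    by apply/is_hermitianmxP; rewrite expr0 scale1r map_mx_id // map_trmx Msym.
  by apply/mxOverP => i j; rewrite mxE.
have /orthomx_spectralP := hermitian_normalmx MCherm.
have /mxOverP := hermitian_spectral_diag_real MCherm.
have := spectral_unit MC.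
move: (spectral_diag MC) (spectralmx MC) => sp V Vu sp_real MCE.
(* The eigenvalues of a Hermitian matrix are real, hence come from K, although the diagonalizing
   matrix V has entries in C. *)
pose dg : 'rV[K]_n.+1 := map_mx re sp.
have spE : sp = map_mx toC dg.
  by apply/rowP => i; rewrite !mxE toC_re.
have {}MCE : map_mx toC M = conjmx (invmx V) (map_mx toC (diag_mx dg)).
  by rewrite conjVmx // map_diag_mx -spE.
(* The minimal polynomial is invariant under conjugation and commutes with extension of scalars, so
   this equality over C descends to K. *)
have minE : mxminpoly (map_mx toC M) = mxminpoly (map_mx toC (diag_mx dg)).
  by rewrite MCE; apply: mxminpoly_uconj; rewrite unitmx_inv.
have {}minE : mxminpoly M = mxminpoly (diag_mx dg).
  by move: minE; rewrite !mxminpoly_map; exact: map_poly_inj.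
(* The minimal polynomial of a diagonal matrix is a product of distinct linear factors, which is the
   criterion for diagonalizability over K. *)
apply/diagonalizableP; exists (undup [seq dg 0 i | i <- enum 'I_n.+1]).
  exact: undup_uniq.
by rewrite -mxminpoly_diag minE dvdpp.
Qed.

Lemma symmetric_diagonalizable (K : realType) n (M : 'M[K]_n.+1) :
  M^T = M -> diagonalizable M.
Proof.
apply: (@symmetric_diagonalizable_in _ _ (real_complex K) (@complex.Re K)) => x.
  by rewrite complex_real.
exact: RRe_real.
Qed.

(* S = r(P)^2, where r interpolates the fourth root at the eigenvalues of P:
   being the square of the symmetric matrix r(P), S is positive. *)
Lemma posdefmx_sqrt_exists (K : realType) n (P : 'M[K]_n) :
  posdefmx P -> exists S : 'M[K]_n, posdefmx S /\ S *m S = P.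
Proof.
case: n P => [|n] P Ppos.
  by exists P; split=> //; rewrite [LHS]flatmx0 [RHS]flatmx0.
have [Psym Pgt0] := Ppos; have Pu := posdefmx_unit Ppos.
have [V Vu /(similar_diagLR Vu)[dg]] := symmetric_diagonalizable Psym.
rewrite conjVmx // => PE.
(* Row w of V is a left eigenvector of P, nonzero because V is invertible, and w P w^T equals the
   eigenvalue times w w^T. *)
have dg_gt0 i : 0 < dg 0 i.
  pose w := row i V.
  have w0 : w^T != 0.
    rewrite -(inj_eq trmx_inj) trmxK trmx0; apply/negP => /eqP wi0.
    have := row_free_unit V; rewrite Vu => /row_freeP[V' VV'].
    have /rowP/(_ i) := congr1 (row i) VV'.
    by rewrite row_mul -/w wi0 mul0mx !mxE eqxx => /esym/eqP; rewrite oner_eq0.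
  have wP : w *m P = dg 0 i *: w.
    by rewrite PE /w -!row_mul !mulmxA mulmxV // mul1mx row_mul
      row_diag_mx -scalemxAl -rowE.
  have := Pgt0 _ w0; rewrite /dot trmxK mulmxA wP -scalemxAl mxE.
  by rewrite pmulr_lgt0 // -[w in w *m _]trmxK dot_gt0.
have [r rE] := poly_interpolation (fun x => Num.sqrt (Num.sqrt x))
  [seq dg 0 i | i <- enum 'I_n.+1].
pose T := horner_mx P r.
have Tsym : T^T = T by rewrite /T trmx_horner_mx Psym.
(* A polynomial in P acts on the diagonal entries, and r(x)^4 = x at each of these positive
   eigenvalues. *)
have T4 : (T *m T) *m (T *m T) = P.
  have -> : (T *m T) *m (T *m T) = horner_mx P (r ^+ 2 ^+ 2).
    by rewrite !rmorphXn /= !expr2.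
  rewrite PE horner_mx_uconjC // horner_mx_diag; congr (_ *m diag_mx _ *m _).
  apply/rowP => i; rewrite mxE !horner_exp rE ?map_f ?mem_enum //.
  by rewrite !sqr_sqrtr // ?sqrtr_ge0 // ltW.
(* T T = T^T T is a Gram matrix, and T is invertible because T^4 = P is. *)
exists (T *m T); split=> //; rewrite -{1}Tsym; apply: posdefmx_gram.
by move: Pu; rewrite -{1}T4 !unitmx_mul => /andP[/andP[]].
Qed.

Lemma sqrtmxP (K : realType) n (P : 'M[K]_n) :
  posdefmx P -> posdefmx (sqrtmx P) /\ sqrtmx P *m sqrtmx P = P.
Proof. by move=> /posdefmx_sqrt_exists; exact: getPex. Qed.

(** * The change of variables z = R u *)

Section RightPreconditioning.
Context {K : realType} {s d d' : nat}.
Variables (A : 'M[K]_(s, d)) (b : 'cV[K]_s) (h : 'cV[K]_d' -> \bar K).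
Variables (W : 'M[K]_(d', d)) (R : 'M[K]_d).
Hypothesis Ru : R \in unitmx.

Lemma composite_precond z :
  composite (lsq (A *m invmx R) b) h (W *m invmx R) z =
  composite (lsq A b) h W (invmx R *m z).
Proof. by rewrite /composite /lsq !mulmxA. Qed.

Lemma argmin_precond :
  argmin (composite (lsq A b) h W) =
    [set invmx R *m z
      | z in argmin (composite (lsq (A *m invmx R) b) h (W *m invmx R))].
Proof.
apply/seteqP; split=> [u umin|_ [z zmin <-] w] /=.
  exists (R *m u); last by rewrite mulKmx.
  by move=> w; rewrite !composite_precond mulKmx.
by have := zmin (R *m w); rewrite !composite_precond mulKmx.
Qed.

Lemma invmx_gram : invmx (R^T *m R) = invmx R *m (invmx R)^T.
Proof.
have RTu : R^T \in unitmx by rewrite unitmx_tr.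
have Gu : R^T *m R \in unitmx by rewrite unitmx_mul RTu.
apply: (can_inj (mulKmx Gu)); rewrite mulmxV // !mulmxA mulmxK //.
by rewrite trmx_inv mulmxV.
Qed.

Lemma forward_step_precond alpha x :
  invmx R *m (x - alpha *: gradient (lsq (A *m invmx R) b) x) =
  invmx R *m x -
    alpha *: (invmx (R^T *m R) *m gradient (lsq A b) (invmx R *m x)).
Proof.
by rewrite !gradient_lsq invmx_gram mulmxBr -scalemxAr trmx_mul !mulmxA.
Qed.

Lemma npd_primal_precond alpha a v :
  invmx R *m npd_primal 1%:M (W *m invmx R) alpha a v =
  npd_primal (R^T *m R) W alpha (invmx R *m a) v.
Proof.
rewrite /npd_primal invmx_gram invmx1 mul1mx mulmxBr -scalemxAr trmx_mul.
by rewrite !mulmxA.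
Qed.

(** The dual updates see the primal iterates only through W R^-1 x, and the bound on beta involves
    the same matrix W (R^T R)^-1 W^T on both sides. Hence one dual sequence v serves both loops, and
    only the average is transported by R^-1. *)
Lemma npd_approx_precond kmax alpha beta a v p :
  npd_approx h (W *m invmx R) 1%:M kmax alpha beta a v p <->
  npd_approx h W (R^T *m R) kmax alpha beta (invmx R *m a) v (invmx R *m p).
Proof.
have pos1 : posdefmx (1%:M : 'M[K]_d).
  by rewrite -(mulmx1 1%:M) -{1}trmx1; apply: posdefmx_gram; rewrite unitmx1.
have BB : W *m invmx R *m invmx 1%:M *m (W *m invmx R)^T =
          W *m invmx (R^T *m R) *m W^T.
  by rewrite invmx_gram invmx1 mulmx1 trmx_mul !mulmxA.
have pE : (p = kmax%:R^-1 *: \sum_(1 <= j < kmax.+1)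
                npd_primal 1%:M (W *m invmx R) alpha a (v j)) <->
    (invmx R *m p = kmax%:R^-1 *: \sum_(1 <= j < kmax.+1)
                npd_primal (R^T *m R) W alpha (invmx R *m a) (v j)).
  under [in X in _ <-> X]eq_bigr do rewrite -npd_primal_precond.
  rewrite -mulmx_sumr scalemxAr; split=> [->//|].
  by apply: (can_inj (mulKVmx Ru)).
have xE k : W *m invmx R *m npd_primal 1%:M (W *m invmx R) alpha a (v k) =
            W *m npd_primal (R^T *m R) W alpha (invmx R *m a) (v k).
  by rewrite -npd_primal_precond mulmxA.
rewrite /npd_approx BB; split=> -[_ beta_ok dual px]; split.
- exact: posdefmx_gram.
- exact: beta_ok.
- by move=> k /dual ->; rewrite xE.
- exact/pE.
- exact: pos1.
- exact: beta_ok.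
- by move=> k /dual ->; rewrite xE.
- exact/pE.
Qed.

Lemma npd_precond kmax alpha beta gamma v00 z zbar v :
  npd (lsq (A *m invmx R) b) h (W *m invmx R) kmax alpha beta gamma
    v00 z zbar v <->
  variable_metric_npd (R^T *m R) (lsq A b) h W kmax alpha beta gamma
    v00 (fun n => invmx R *m z n) (fun n => invmx R *m zbar n) v.
Proof.
(* Extrapolation is linear; injectivity of R^-1 gives the converse. *)
have extrap n : (zbar n = z n + gamma n *: (z n - z n.-1)) <->
  (invmx R *m zbar n =
   invmx R *m z n + gamma n *: (invmx R *m z n - invmx R *m z n.-1)).
  rewrite -mulmxBr scalemxAr -mulmxDr; split=> [->//|].
  by apply: (can_inj (mulKVmx Ru)).
split=> -[v0 warm ext approx]; split.
- exact: v0.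
- exact: warm.
- by move=> n; exact/extrap.
- by move=> n; rewrite -forward_step_precond; apply/npd_approx_precond.
- exact: v0.
- exact: warm.
- by move=> n; exact/extrap.
- by move=> n; apply/npd_approx_precond; rewrite forward_step_precond.
Qed.

End RightPreconditioning.

Theorem mainTheorem2 (K : realType) (s d d' : nat)
  (A : 'M[K]_(s, d)) (b : 'cV[K]_s)
  (h : 'cV[K]_d' -> \bar K) (W : 'M[K]_(d', d))
  (h_proper : proper_efun h) (h_convex : convex_efun h)
  (h_lsc : lower_semicontinuous h)
  (W_qualified : exists u_star : 'cV[K]_d, relint (effdom h) (W *m u_star))
  (solvable : argmin (composite (lsq A b) h W) !=set0) :
  (forall R : 'M[K]_d, R \in unitmx ->
    argmin (composite (lsq A b) h W) =
      [set invmx R *m z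
        | z in argmin (composite (lsq (A *m invmx R) b) h (W *m invmx R))]
    /\
    forall (kmax : nat) (alpha beta gamma : nat -> K) (v00 : 'cV[K]_d')
      (z zbar : nat -> 'cV[K]_d) (v : nat -> nat -> 'cV[K]_d'),
      (1 <= kmax)%N ->
      (forall n, 0 < alpha n) -> (forall n, 0 <= gamma n) ->
      npd (lsq (A *m invmx R) b) h (W *m invmx R) kmax alpha beta gamma
        v00 z zbar v
      <->
      variable_metric_npd (R^T *m R) (lsq A b) h W kmax alpha beta gamma
        v00 (fun n => invmx R *m z n) (fun n => invmx R *m zbar n) v)
  /\
  (forall (eta : K) (P : 'M[K]_d), 0 < eta -> posdefmx P ->
    (forall lambda : K, eigenvalue P lambda -> eta <= lambda) ->
    let R := sqrtmx P in
    [/\ R \in unitmx, R^T *m R = P &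
      forall (kmax : nat) (alpha beta gamma : nat -> K) (v00 : 'cV[K]_d')
        (z zbar : nat -> 'cV[K]_d) (v : nat -> nat -> 'cV[K]_d'),
        (1 <= kmax)%N ->
        (forall n, 0 < alpha n) -> (forall n, 0 <= gamma n) ->
        npd (lsq (A *m invmx R) b) h (W *m invmx R) kmax alpha beta gamma
          v00 z zbar v
        <->
        variable_metric_npd P (lsq A b) h W kmax alpha beta gamma
          v00 (fun n => invmx R *m z n) (fun n => invmx R *m zbar n) v]).
Proof.
split=> [R Ru|eta P _ Ppos _ R].
  by split=> [|*]; [exact: argmin_precond|exact: npd_precond].
have [Rpos RR] := sqrtmxP Ppos; have Ru : R \in unitmx := posdefmx_unit Rpos.
(* The square root is symmetric, so R^T R = R R. *)
have RTR : R^T *m R = P by have [-> _] := Rpos.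
split=> // kmax alpha beta gamma v00 z zbar v _ _ _.
have := npd_precond A b h W Ru kmax alpha beta gamma v00 z zbar v.
by rewrite RTR.
Qed.
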